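(* Let $n,\nu$, $0=n_0<n_1<\cdots<n_\nu=n$, and $\bm h\in\mathbb{N}^n$ be as in the context, with $\bm h$ block monotone. Let $l:[0,1]\to[0,\infty)$ and $r,a,d:[0,1]\to\mathbb{N}$ be measurable with $(r(x),a(x),d(x))\in\mathcal{S}$ for all $x$ and $\int_0^1 l(x)r(x)\,dx<\infty$, and write $\mathcal{R}^c=\{(l(x),r(x),a(x),d(x)):x\in[0,1]\}$. Then $\bm h$ is adequate for $\mathcal{R}^c$ if and only if $W^c_{k_1\cdots k_\nu}(\bm h,\mathcal{R}^c)\ge0$ for every integer tuple $(k_1,\dots,k_\nu)$ with $0\le k_\kappa\le n_\kappa-n_{\kappa-1}$ for all $\kappa$.
   Context: Integers $0=n_0<n_1<\dots<n_\nu=n$ are fixed ($1\le\nu\le n$). The service set is $\mathcal{S}=\{(r,a,d)\in\mathbb{N}^3: a<d\le\nu,\ 0<r\le n_d-n_a\}$; service $(r,a,d)$ means one unit of power per unit of load in exactly $r$ of the slots $n_a+1,\dots,n_d$. $\bm h=(h_1,\dots,h_n)\in\mathbb{N}^n$ is block monotone: for each $\kappa$, $h_i\ge h_j$ whenever $n_{\kappa-1}+1\le i<j\le n_\kappa$. A continuum of consumers is indexed by $x\in[0,1]$; consumers in $[x,x+dx]$ demand $l(x)\,dx$ units/slot of power for $r(x)$ slots among slots $n_{a(x)}+1,\dots,n_{d(x)}$. Adequacy of $\bm h$ for $\mathcal{R}^c$ means: there exists a measurable $A:[0,1]\times\{1,\dots,n\}\to[0,1]$ with $A(x,j)=0$ for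 $j\notin\{n_{a(x)}+1,\dots,n_{d(x)}\}$, $\sum_{j=1}^nA(x,j)=r(x)$ for all $x$, and $\int_0^1 l(x)A(x,j)\,dx\le h_j$ for all $j$. With $[t]^+=\max\{t,0\}$, $$W^c_{k_1\cdots k_\nu}(\bm h,\mathcal{R}^c)=\sum_{\kappa=1}^{\nu}\sum_{j=n_{\kappa-1}+k_\kappa+1}^{n_\kappa}h_j-\int_0^1 l(x)\Big[r(x)-\sum_{\kappa=a(x)+1}^{d(x)}k_\kappa\Big]^+dx.$$ *)

(* Defs.v *)
From HB Require Import structures.
From mathcomp Require Import all_boot all_order all_algebra.
From mathcomp Require Import all_classical all_reals all_analysis.
Set Implicit Arguments. Unset Strict Implicit. Unset Printing Implicit Defensive.
Import Order.TTheory GRing.Theory Num.Theory.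
Local Open Scope classical_set_scope.
Local Open Scope ring_scope.

Definition breakpoints (n nu : nat) (N : nat -> nat) : Prop :=
  [/\ (1 <= nu <= n)%N, N 0%N = 0%N, N nu = n &
      forall kappa, (kappa < nu)%N -> (N kappa < N kappa.+1)%N].

(* Slots are 1..n; h j is the value in slot j (values outside 1..n unused).
   Block monotone: within each block n_{k-1}+1 .. n_k, h is nonincreasing. *)
Definition block_monotone (nu : nat) (N : nat -> nat) (h : nat -> nat) : Prop :=
  forall kappa, (1 <= kappa <= nu)%N ->
    forall i j, (N kappa.-1 + 1 <= i)%N -> (i < j)%N -> (j <= N kappa)%N ->
      (h j <= h i)%N.

Definition in_service_set (nu : nat) (N : nat -> nat) (r a d : nat) : Prop :=
  [/\ (a < d)%N, (d <= nu)%N, (0 < r)%N & (r <= N d - N a)%N].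

Definition adequate_c {R : realType} (n : nat) (N : nat -> nat) (h : nat -> nat)
  (l : R -> R) (r a d : R -> nat) : Prop :=
  exists A : R -> nat -> R,
    [/\ forall j, (1 <= j <= n)%N -> measurable_fun (`[0%R, 1%R] : set R) (fun x => A x j),
        forall x, x \in `[0%R, 1%R] -> forall j, (1 <= j <= n)%N ->
          0 <= A x j <= 1,
        forall x, x \in `[0%R, 1%R] -> forall j, (1 <= j <= n)%N ->
          ~~ (N (a x) + 1 <= j <= N (d x))%N -> A x j = 0,
        forall x, x \in `[0%R, 1%R] ->
          \sum_(1 <= j < n.+1) A x j = (r x)%:R &
        forall j, (1 <= j <= n)%N ->
          (\int[@lebesgue_measure R]_(x in (`[0%R, 1%R] : set R)) (l x * A x j)%:E
             <= ((h j)%:R)%:E)%E ].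

(* W^c_{k_1...k_nu}(h, R^c); [r - sum k]^+ is truncated nat subtraction. *)
Definition Wc {R : realType} (nu : nat) (N : nat -> nat) (h : nat -> nat)
  (l : R -> R) (r a d : R -> nat) (k : nat -> nat) : \bar R :=
  ((\sum_(1 <= kappa < nu.+1) \sum_(N kappa.-1 + k kappa + 1 <= j < (N kappa).+1)
        ((h j)%:R : R))%:E
   - \int[@lebesgue_measure R]_(x in (`[0%R, 1%R] : set R))
        (l x * ((r x - \sum_(a x + 1 <= kappa < (d x).+1) k kappa)%N)%:R)%:E)%E.

(* Main.v *)
(* Only finitely many triples s = (r, a, d) occur, so consumers can be lumped
   by type with total loads c_s = int l 1[type = s] (finite since r >= 1), and
   adequacy becomes feasibility of a transportation problem: types s with
   demands c_s r_s, slots j with supplies h_j, and edge capacities c_s on the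
   window of s.  The cut conditions of that problem, minimised over slot sets
   with k_kappa elements of block kappa outside the set, are the inequalities
   W >= 0, because in each block the last slots have the smallest h.
   Conversely the cut conditions suffice: fix the flow on one edge e at a time.
   Each cut crossed by e bounds its flow from below, and each cut having only
   the slot end of e on its source side bounds it from above; these bounds are
   compatible by submodularity of cuts. *)
Require Import Defs.
From HB Require Import structures.
From mathcomp Require Import all_boot all_order all_algebra.
From mathcomp Require Import all_classical all_reals all_analysis.
From mathcomp Require Import measurable_realfun zify lra.
Set Implicit Arguments.
Unset Strict Implicit.
Import Order.TTheory GRing.Theory Num.Theory.
Local Open Scope classical_set_scope.
Local Open Scope ring_scope.

(** * Cuts and feasibility of the transportation problem *)

Lemma sum_point (R : nmodType) (I : finType) (P : pred I) (e : I) (t : R) :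
  \sum_(i | P i) (if i == e then t else 0) = if P e then t else 0.
Proof.
rewrite -big_mkcondr /=; case: ifPn => [Pe|nPe].
  by rewrite (big_pred1 e) // => i /=; case: eqVneq => [->|]; rewrite ?Pe ?andbF.
rewrite big_pred0 // => i.
by case: eqVneq => [->|]; rewrite ?andbF // andbT (negbTE nPe).
Qed.

(* S and T are the types and the slots on the source side of the cut; the slack
   is its capacity minus the total demand. *)
Definition cut_slack {R : realFieldType} {I J : finType} (u : I * J -> R)
    (b : I -> R) (h : J -> R) (S : {set I}) (T : {set J}) : R :=
  \sum_(p | (p.1 \in S) && (p.2 \notin T)) u p + \sum_(j in T) h j
  - \sum_(s in S) b s.

(** The sums over types and over slots are modular, so only the edge sums matter, and these compare
    edge by edge. The edge [e] crosses the first cut but neither the union nor the intersection,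
    which leaves room for the extra [u e]. *)
Lemma cut_slack_submod (R : realFieldType) (I J : finType) (u : I * J -> R)
    (b : I -> R) (h : J -> R) (e : I * J) (S1 S2 : {set I}) (T1 T2 : {set J}) :
  (forall p, 0 <= u p) ->
  e.1 \in S1 -> e.2 \notin T1 -> e.1 \notin S2 -> e.2 \in T2 ->
  u e + cut_slack u b h (S1 :|: S2) (T1 :|: T2)
      + cut_slack u b h (S1 :&: S2) (T1 :&: T2)
  <= cut_slack u b h S1 T1 + cut_slack u b h S2 T2.
Proof.
move=> u0 eS1 eT1 eS2 eT2; rewrite /cut_slack.
have modular (K : finType) (f : K -> R) (A B : {set K}) :
    \sum_(i in A :|: B) f i + \sum_(i in A :&: B) f i
    = \sum_(i in A) f i + \sum_(i in B) f i.
  rewrite ![\sum_(i in _) _]big_mkcond -!big_split; apply: eq_bigr => i _.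
  by rewrite !inE; case: (i \in A); case: (i \in B); rewrite /= ?addr0 ?add0r.
have := modular _ h T1 T2; have := modular _ b S1 S2.
suff: u e + \sum_(p | (p.1 \in S1 :|: S2) && (p.2 \notin T1 :|: T2)) u p
  + \sum_(p | (p.1 \in S1 :&: S2) && (p.2 \notin T1 :&: T2)) u p
  <= \sum_(p | (p.1 \in S1) && (p.2 \notin T1)) u p
   + \sum_(p | (p.1 \in S2) && (p.2 \notin T2)) u p by lra.
have -> : u e = \sum_p (if p == e then u e else 0) by rewrite sum_point.
rewrite ![\sum_(p | _ && _) _]big_mkcond -!big_split; apply: ler_sum => p _ /=.
have := u0 p; rewrite !inE; case: eqVneq => [->|_] => up.
  by rewrite eS1 (negbTE eS2) eT2 (negbTE eT1) /=; lra.
by case: (p.1 \in S1); case: (p.1 \in S2); case: (p.2 \in T1); case: (p.2 \in T2);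
  rewrite /=; lra.
Qed.

(* Demands are stated as lower bounds so that the residual demands of the
   induction may become negative. *)
Lemma transport_feasible (R : realFieldType) (I J : finType) (u : I * J -> R)
    (b : I -> R) (h : J -> R) :
  (forall p, 0 <= u p) -> (forall S T, 0 <= cut_slack u b h S T) ->
  exists y : I * J -> R,
    [/\ forall p, 0 <= y p <= u p,
        forall s, b s <= \sum_j y (s, j) &
        forall j, \sum_s y (s, j) <= h j].
Proof.
(* The induction runs over a list containing every edge of nonzero capacity. *)
have [E] : exists E : seq (I * J), forall p, p \notin E -> u p = 0.
  by exists (enum {: I * J}) => p; rewrite mem_enum.
elim: E u b h => [|e E IH] u b h uE u0 slack0.
  (* With all capacities zero, the cuts on a single type and on a single slot give [b s <= 0] and
     [0 <= h j], so the zero flow works. *)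
  exists (fun=> 0); split=> [p|s|j]; first by rewrite lexx u0.
    rewrite big1 //; have := slack0 [set s]%SET finset.set0.
    rewrite /cut_slack big_set1 big_set0 big1 => [|p _]; last exact: uE.
    by lra.
  rewrite big1 //; have := slack0 finset.set0 [set j]%SET.
  by rewrite /cut_slack big_set1 big_set0 big1 => [|p _]; [lra | exact: uE].
(* When [e] carries [t] and is then deleted, a cut crossed by [e] loses [u e] and gains [t]: its
   slack stays nonnegative exactly when [t] is at least [lower q]. The [t] below is the least
   nonnegative value that suits all these cuts. *)
pose lower (q : {set I} * {set J}) := u e - cut_slack u b h q.1 q.2.
pose t := \big[Order.max/0]_(q : {set I} * {set J} | (e.1 \in q.1) && (e.2 \notin q.2)) lower q.
have t0 : 0 <= t by apply: bigmax_ge_id.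
have tle (S : {set I}) (T : {set J}) :
    e.1 \notin S -> e.2 \in T -> t <= cut_slack u b h S T.
  move=> eS eT; apply: bigmax_le => // -[S1 T1] /= /andP[eS1 eT1].
  have := cut_slack_submod b h u0 eS1 eT1 eS eT.
  have := slack0 (S1 :|: S) (T1 :|: T); have := slack0 (S1 :&: S) (T1 :&: T).
  by rewrite /lower /=; lra.
have tge (S : {set I}) (T : {set J}) :
    e.1 \in S -> e.2 \notin T -> u e - cut_slack u b h S T <= t.
  by move=> eS eT; apply: (le_bigmax_cond _ lower (j := (S, T))); rewrite eS.
have tu : t <= u e.
  by apply: bigmax_le => // -[S T] _; rewrite /lower /=; have := slack0 S T; lra.
pose u' p := u p + (if p == e then - u e else 0).
pose b' s := b s + (if s == e.1 then - t else 0).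
pose h' j := h j + (if j == e.2 then - t else 0).
have u'0 p : 0 <= u' p.
  by rewrite /u'; case: eqVneq => [->|_]; rewrite ?subrr ?addr0.
have [|S T|y [yu yb yh]] := IH u' b' h' _ u'0.
- move=> p pE; rewrite /u'; case: eqVneq => [->|pe]; first by rewrite subrr.
  by rewrite addr0; apply: uE; rewrite inE negb_or pe.
(* The slack changes only if exactly one end of [e] is on the source side: [tge] settles the type
   end, [tle] the slot end. *)
- have -> : cut_slack u' b' h' S T = cut_slack u b h S T
      - (if (e.1 \in S) && (e.2 \notin T) then u e else 0)
      - (if e.2 \in T then t else 0) + (if e.1 \in S then t else 0).
    rewrite /cut_slack /u' /b' /h' !big_split /= !sum_point.
    by do !case: ifP => _; lra.
  have := slack0 S T; have := tle S T; have := tge S T.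
  case: (e.1 \in S); case: (e.2 \in T) => //=;
    try (move=> _ /(_ isT isT)); try (move=> /(_ isT isT) + _); lra.
exists (fun p => y p + (if p == e then t else 0)); split=> [p|s|j].
- have := yu p; have := u0 p; rewrite /u'; case: eqVneq => [->|_]; first lra.
  by rewrite !addr0.
- rewrite big_split /=; have := yb s; rewrite /b'.
  have -> : \sum_j (if (s, j) == e then t else 0) = if s == e.1 then t else 0.
    under eq_bigr do rewrite -pair_eqE /pair_eq /=.
    case: eqVneq => _ /=; last exact: big1.
    by rewrite sum_point.
  by case: ifP => _; lra.
- rewrite big_split /=; have := yh j; rewrite /h'.
  have -> : \sum_s (if (s, j) == e then t else 0) = if j == e.2 then t else 0.
    under eq_bigr do rewrite -pair_eqE /pair_eq /= andbC.
    case: eqVneq => _ /=; last exact: big1.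
    by rewrite sum_point.
  by case: ifP => _; lra.
Qed.

(** * Sums over slots and blocks *)

(** Both sides sum equally many slots, and the left takes the last ones, where [h] is smallest. In
    the induction on [q], a new slot in [T] adds the same term to both sides; a new slot outside [T]
    shifts the tail one place to the right, which lowers it termwise. *)
Lemma sum_tail_le (h : nat -> nat) (T : pred nat) (p q : nat) :
  (p <= q)%N ->
  (forall i j, p < i -> i < j -> j <= q -> h j <= h i)%N ->
  (\sum_(p + \sum_(p.+1 <= j < q.+1) ~~ T j + 1 <= j < q.+1) h j
    <= \sum_(p.+1 <= j < q.+1 | T j) h j)%N.
Proof.
elim: q => [|q IH].
  by rewrite leqn0 => /eqP -> _; rewrite [leqLHS]big_geq // addn1.
rewrite leq_eqVlt => /orP[/eqP ->|]; first by move=> _; rewrite [leqLHS]big_geq // addn1 ltnS leq_addr.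
rewrite ltnS => pq hmono; have pSq : (p < q.+1)%N by [].
have {}IH := IH pq (fun i j pi ij jq => hmono i j pi ij (leqW jq)).
rewrite (@big_nat_recr _ _ _ q.+1 p.+1) //=. rewrite [leqRHS]big_mkcond (@big_nat_recr _ _ _ q.+1 p.+1) //=.
rewrite [leqRHS]big_mkcond /= in IH.
set k := (\sum_(p.+1 <= j < q.+1) _)%N in IH *.
have kq : (p + k <= q)%N.
  rewrite -leq_subRL // -[leqRHS]muln1 -subSS -sum_nat_const_nat.
  by apply: leq_sum => j _; case: (T j).
case: (T q.+1) => /=.
  rewrite addn0 big_nat_recr /=; last by rewrite addn1 ltnS.
  by rewrite leq_add2r.
rewrite !addn0 (addn1 k) (addnS p) addSn big_add1 /=; apply: leq_trans IH.
rewrite big_nat [leqRHS]big_nat; apply: leq_sum => j /andP[pj jq].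
by apply: hmono; lia.
Qed.

Lemma leq_steps (N : nat -> nat) (a d : nat) :
  (a <= d)%N -> (forall k, (a <= k < d)%N -> (N k <= N k.+1)%N) ->
  (N a <= N d)%N.
Proof.
elim: d => [|d IH]; first by rewrite leqn0 => /eqP ->.
rewrite leq_eqVlt => /orP[/eqP -> //|]; rewrite ltnS => ad Nstep.
apply: leq_trans (Nstep d _); last by rewrite ad /=.
by apply: IH => // k /andP[ak kd]; apply: Nstep; rewrite ak ltnW.
Qed.

Lemma sum_blocks (V : nmodType) (N : nat -> nat) (F : nat -> V) (a d : nat) :
  (a <= d)%N -> (forall k, (a <= k < d)%N -> (N k <= N k.+1)%N) ->
  \sum_((N a).+1 <= j < (N d).+1) F j
  = \sum_(a.+1 <= k < d.+1) \sum_((N k.-1).+1 <= j < (N k).+1) F j.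
Proof.
elim: d => [|d IH]; first by rewrite leqn0 => /eqP -> _; rewrite !big_geq.
rewrite leq_eqVlt => /orP[/eqP -> _|]; first by rewrite !big_geq.
rewrite ltnS => ad Nstep.
have Nstep' k : (a <= k < d)%N -> (N k <= N k.+1)%N.
  by move=> /andP[ak kd]; apply: Nstep; rewrite ak ltnW.
rewrite [RHS]big_nat_recr //= -IH // (@big_cat_nat _ _ _ (N d).+1) //= ltnS.
  exact: leq_steps.
by rewrite Nstep ?ad /=.
Qed.

(** * Measurability and integrals of functions of the type *)

Lemma measurable_fun_fin_class d d' (T : measurableType d)
    (T' : measurableType d') (I : finType) (D : set T) (tau : T -> I)
    (G : I -> T') :
  (forall s, measurable (D `&` [set x | tau x = s])) ->
  measurable_fun D (fun x => G (tau x)).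
Proof.
move=> mtau _ Y mY.
have -> : D `&` (fun x => G (tau x)) @^-1` Y
    = \bigcup_(s in [set s | Y (G s)]) (D `&` [set x | tau x = s]).
  apply/seteqP; split=> [x [Dx Yx]|x [s Ys [Dx /= xs]]].
    by exists (tau x).
  by split; rewrite //= xs.
apply: fin_bigcup_measurable => //; exact: finite_finset.
Qed.

(** The integrand splits into finitely many nonnegative pieces, one per class; nonnegativity lets
    sum and integral be exchanged even when some class integrals are infinite. *)
Lemma ge0_integral_fin_class d (T : measurableType d) (R : realType)
    (mu : {measure set T -> \bar R}) (I : finType) (D : set T) (tau : T -> I)
    (l : T -> R) (F : I -> R) :
  measurable D -> (forall s, measurable (D `&` [set x | tau x = s])) ->
  measurable_fun D l -> (forall x, D x -> 0 <= l x) -> (forall s, 0 <= F s) ->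
  (\int[mu]_(x in D) (l x * F (tau x))%:E
   = \sum_s (F s)%:E * \int[mu]_(x in D) (l x * (tau x == s)%:R)%:E)%E.
Proof.
move=> mD mtau ml l0 F0.
have ml_class s : measurable_fun D (EFin \o (fun x => l x * (tau x == s)%:R)).
  apply/measurable_EFinP; apply: measurable_funM => //.
  exact: (measurable_fun_fin_class (T' := R) (fun s' => (s' == s)%:R : R)).
have l_class0 s x : D x -> (0 <= (l x * (tau x == s)%:R)%:E)%E.
  by move=> Dx; rewrite lee_fin mulr_ge0 ?l0.
transitivity (\int[mu]_(x in D)
    (\sum_s (F s)%:E * (l x * (tau x == s)%:R)%:E))%E.
  apply: eq_integral => x _; rewrite (bigD1 (tau x)) //= big1 => [|s].
    by rewrite eqxx mulr1 addr0 -EFinM mulrC.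
  by rewrite eq_sym => /negbTE ->; rewrite mulr0 mule0.
rewrite ge0_integral_sum //=.
- apply: eq_bigr => s _; apply: ge0_integralZl_EFin => //.
    by move=> x; exact: l_class0.
  exact: ml_class.
- by move=> s'; exact: measurable_funeM (ml_class s').
- by move=> s' x Dx; rewrite mule_ge0 ?l_class0 ?lee_fin.
Qed.

(** * From flows to fractional allocations *)

(** For fixed [T], the tightest cut takes as [S] the types with [r s] above the number of window
    slots outside [T]; this turns differences into truncated ones, so the hypothesis on [T] covers
    all cuts. The flow, divided by the load of its type, is then scaled down to meet each demand
    exactly. *)
Lemma fractional_allocation (R : realFieldType) (I J : finType) (c : I -> R)
    (win : I -> {set J}) (r : I -> nat) (h : J -> R) :
  (forall s, 0 <= c s) -> (forall s, (r s <= #|win s|)%N) ->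
  (forall T : {set J},
    \sum_s c s * (r s - #|win s :\: T|)%N%:R <= \sum_(j in T) h j) ->
  exists A : I -> J -> R,
    [/\ forall s j, 0 <= A s j <= 1,
        forall s j, j \notin win s -> A s j = 0,
        forall s, \sum_j A s j = (r s)%:R &
        forall j, \sum_s c s * A s j <= h j].
Proof.
move=> c0 rwin hall.
pose u (p : I * J) := if p.2 \in win p.1 then c p.1 else 0.
have u0 p : 0 <= u p by rewrite /u; case: ifP.
have [S T|y [yu yb yh]] :=
    transport_feasible (b := fun s => c s * (r s)%:R) (h := h) u0.
  rewrite /cut_slack.
  have -> : \sum_(p | (p.1 \in S) && (p.2 \notin T)) u p
      = \sum_(s in S) c s * #|win s :\: T|%:R.
    transitivity (\sum_(s in S) \sum_(j | j \notin T) u (s, j)).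
      by rewrite pair_big; apply: eq_bigr => -[].
    apply: eq_bigr => s _; rewrite -big_mkcondr mulr_natr -sumr_const.
    by apply: eq_bigl => j; rewrite !inE.
  rewrite addrAC -sumrB -lerBlDl sub0r -sumrN.
  apply: le_trans (hall T).
  rewrite [leLHS]big_mkcond; apply: ler_sum => s _; case: ifP => _; last first.
    by rewrite mulr_ge0.
  rewrite opprB -mulrBr ler_wpM2l // lerBlDr -natrD ler_nat; lia.
(* A type of zero load receives no flow but still needs [r s] slots, so its whole window is taken as
   weight, with [g s = 1] in place of the load. *)
pose w s j := if c s == 0 then (j \in win s)%:R else y (s, j).
pose g s := if c s == 0 then 1 else c s.
have g0 s : 0 < g s.
  by rewrite /g; case: eqVneq => // cs; rewrite lt_neqAle eq_sym cs c0.
have w0 s j : 0 <= w s j.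
  by rewrite /w; case: ifP => _ //; have /andP[] := yu (s, j).
have wg s j : w s j <= g s.
  rewrite /w /g; case: ifP => _; first by case: (_ \in _).
  by have /andP[_] := yu (s, j); rewrite /u /=; case: ifP => _ // /le_trans ->.
have rw s : g s * (r s)%:R <= \sum_j w s j.
  rewrite /g /w; case: ifP => _; last exact: yb.
  by rewrite mul1r -natr_sum ler_nat -big_mkcond sum1_card.
have r0 s : \sum_j w s j = 0 -> r s = 0%N.
  move=> W0; have := rw s; rewrite W0 pmulr_rle0 // (ler_nat _ _ 0) leqn0.
  by move/eqP.
have W0 s : 0 <= \sum_j w s j by apply: sumr_ge0.
(* By [rw] the scaled value is at most [w s j / g s], hence at most 1. A zero row sum forces
   [r s = 0], and division by zero then gives the right value 0. *)
exists (fun s j => w s j * (r s)%:R / \sum_j w s j); split.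
- move=> s j; rewrite divr_ge0 ?mulr_ge0 //=.
  have [->|Ws] := eqVneq (\sum_j w s j) 0; first by rewrite invr0 mulr0.
  rewrite ler_pdivrMr ?mul1r; last by rewrite lt_neqAle eq_sym Ws W0.
  by apply: le_trans (rw s); rewrite ler_wpM2r.
- move=> s j js; suff -> : w s j = 0 by rewrite !mul0r.
  rewrite /w (negbTE js); case: ifP => // _.
  by apply/eqP; rewrite eq_le andbC; have := yu (s, j); rewrite /u /= (negbTE js).
- move=> s; rewrite -!mulr_suml.
  have [Ws|Ws] := eqVneq (\sum_j w s j) 0; first by rewrite Ws (r0 s Ws) !mul0r.
  by rewrite mulrAC divff ?mul1r.
- move=> j; apply: le_trans (yh j); apply: ler_sum => s _.
  have /andP[ys0 _] := yu (s, j).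
  have [->|Ws] := eqVneq (\sum_j w s j) 0; first by rewrite invr0 !mulr0.
  rewrite mulrA ler_pdivrMr; last by rewrite lt_neqAle eq_sym Ws W0.
  have := rw s; rewrite /w /g; case: eqVneq => [-> _|cs rws].
    by rewrite mul0r mulr_ge0 // sumr_ge0.
  by rewrite mulrCA ler_wpM2l.
Qed.

(* 'I_n is 0-based: the ordinal i stands for slot i.+1. *)
Definition slot_pred (n : nat) (T : {set 'I_n}) (j : nat) : bool :=
  if insub j.-1 is Some i then i \in T else false.

Lemma sum_slots (V : nmodType) (n p q : nat) (F : nat -> V) :
  (q <= n)%N ->
  \sum_(p.+1 <= j < q.+1) F j = \sum_(i < n | (p <= i < q)%N) F i.+1.
Proof.
move=> qn; rewrite big_add1 /= (big_nat_widen _ _ _ _ _ qn).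
by rewrite (big_nat_widenl _ 0) // big_mkord; apply: eq_bigl => i; rewrite andbC.
Qed.

Lemma slot_predS (n : nat) (T : {set 'I_n}) (i : 'I_n) :
  slot_pred T i.+1 = (i \in T).
Proof. by rewrite /slot_pred /= valK. Qed.

Lemma card_window (n p q : nat) (T : {set 'I_n}) :
  (q <= n)%N ->
  #|[set j : 'I_n | (p <= j < q)%N]%SET :\: T|
  = (\sum_(p.+1 <= j < q.+1) ~~ slot_pred T j)%N.
Proof.
move=> qn; rewrite (sum_slots _ _ qn) -sum1_card big_mkcond [RHS]big_mkcond.
apply: eq_bigr => i _; rewrite slot_predS !inE.
by case: (i \in T); case: ifP.
Qed.

(** * Necessity of the inequalities *)

(** A consumer gets at most [k kappa] slots' worth from the first [k kappa] slots of each block in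
    its window, so the tails must supply the rest of [r x]. Integrated against [l], the supply in
    the tails is bounded by [h]. *)
Lemma adequate_c_Wc_ge0 (R : realType) (n nu : nat) (N : nat -> nat)
    (h : nat -> nat) (l : R -> R) (r a d : R -> nat) (k : nat -> nat) :
  breakpoints n nu N ->
  measurable_fun (`[0%R, 1%R] : set R) l ->
  measurable_fun (`[0%R, 1%R] : set R)
    (fun x => l x * (r x - \sum_(a x + 1 <= kappa < (d x).+1) k kappa)%N%:R) ->
  (forall x, x \in `[0%R, 1%R] -> 0 <= l x) ->
  (forall x, x \in `[0%R, 1%R] -> in_service_set nu N (r x) (a x) (d x)) ->
  (forall kappa, (1 <= kappa <= nu)%N -> (k kappa <= N kappa - N kappa.-1)%N) ->
  adequate_c n N h l r a d ->
  (0 <= Wc nu N h l r a d k)%E.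
Proof.
move=> [_ N0 Nnu Nlt] ml mlr l0 serv kN [A [mA A01 A0 Ar Ah]].
have Nle i j : (i <= j <= nu)%N -> (N i <= N j)%N.
  move=> /andP[ij jnu]; apply: leq_steps => // m /andP[_ mj].
  by rewrite ltnW // Nlt // (leq_trans mj).
(* Extending [A] by 0 outside the slots makes its bounds and measurability hold for every index, as
   the sum lemmas for integrals require. *)
pose b x j := if (1 <= j <= n)%N then A x j else 0.
have b0 x j : x \in `[0, 1] -> 0 <= b x j <= 1.
  by move=> xD; rewrite /b; case: ifP => jn; [exact: A01 | rewrite lexx ler01].
have mb j : measurable_fun (`[0%R, 1%R] : set R) (fun x => b x j).
  have := mA j; rewrite /b; case: (1 <= j <= n)%N => [|_]; first exact.
  exact: measurable_cst.
have mlb j :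
    measurable_fun (`[0%R, 1%R] : set R) (EFin \o (fun x => l x * b x j)).
  by apply/measurable_EFinP; apply: measurable_funM.
have lb0 j x : x \in `[0, 1] -> (0 <= (l x * b x j)%:E)%E.
  by move=> xD; rewrite lee_fin mulr_ge0 ?l0 //; have /andP[] := b0 x j xD.
rewrite /Wc sube_ge0 ?orbT //.
pose tail kappa := index_iota (N kappa.-1 + k kappa + 1) (N kappa).+1.
apply: (@le_trans _ _ (\int[@lebesgue_measure R]_(x in (`[0%R, 1%R] : set R))
    (\sum_(1 <= kappa < nu.+1) \sum_(j <- tail kappa) (l x * b x j)%:E))%E); last first.
  rewrite ge0_integral_sum //=.
  - have -> : (\sum_(1 <= kappa < nu.+1) \sum_(j <- tail kappa) ((h j)%:R : R))%:E
        = (\sum_(1 <= kappa < nu.+1) \sum_(j <- tail kappa) ((h j)%:R : R)%:E)%E.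
      by under [RHS]eq_bigr do rewrite sumEFin; rewrite sumEFin.
    apply: lee_sum => kappa _; rewrite ge0_integral_sum //=.
      apply: lee_sum => j _.
      have := Ah j; rewrite /b; case: (1 <= j <= n)%N => [|_]; first exact.
      by under eq_integral do rewrite mulr0; rewrite integral0 lee_fin.
  - by move=> kappa; apply: emeasurable_sum.
  - by move=> kappa x xD; apply: sume_ge0 => j _; apply: lb0.
apply: ge0_le_integral => //=.
- by move=> x xD; rewrite lee_fin mulr_ge0 ?l0.
- exact/measurable_EFinP.
- by apply: emeasurable_sum => kappa; apply: emeasurable_sum.
move=> x xD.
under [leRHS]eq_bigr do rewrite sumEFin.
rewrite sumEFin lee_fin.
under [leRHS]eq_bigr do rewrite -mulr_sumr.
rewrite -mulr_sumr ler_wpM2l ?l0 //.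
have [ad dnu r0 rN] := serv x xD.
set K := (\sum_(_ <= _ < _) k _)%N.
have tail0 : 0 <= \sum_(1 <= kappa < nu.+1) \sum_(j <- tail kappa) b x j.
  apply: sumr_ge0 => kappa _; apply: sumr_ge0 => j _.
  by have /andP[] := b0 x j xD.
suff rK : (r x)%:R
    <= K%:R + \sum_(1 <= kappa < nu.+1) \sum_(j <- tail kappa) b x j.
  have [/eqP -> //|Kr] := leqP (r x) K.
  by rewrite natrB 1?ltnW // lerBlDl.
have -> : K = (\sum_(1 <= kappa < nu.+1)
    if (a x < kappa <= d x)%N then k kappa else 0)%N.
  rewrite /K addn1 (big_nat_widen _ _ nu.+1) ?ltnS // (big_nat_widenl _ 1) //.
  by rewrite big_mkcond; apply: eq_bigr => kappa _; rewrite andbC ltnS.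
rewrite -(Ar x xD) (eq_big_nat _ _ (F2 := b x)); last first.
  by move=> j jn; rewrite /b -ltnS jn.
have := @sum_blocks R N (b x) 0%N nu isT; rewrite N0 Nnu => ->; last first.
  by move=> kappa /andP[_ knu]; rewrite ltnW // Nlt.
rewrite natr_sum -big_split /= big_nat [leRHS]big_nat.
apply: ler_sum => kappa knu.
have knu' : (0 < kappa <= nu)%N by rewrite -ltnS.
have kle := kN _ knu'; have Nk : (N kappa.-1 <= N kappa)%N by apply: Nle; lia.
(* Each block is split after its first [k kappa] slots: there [b] is at most 1 inside the window and
   0 outside it. *)
rewrite (@big_cat_nat _ _ _ (N kappa.-1 + k kappa + 1)%N) /=; [|lia|lia].
rewrite lerD2r; case: ifP => kad.
  rewrite [X in X%:R](_ : _ =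
      (\sum_((N kappa.-1).+1 <= j < N kappa.-1 + k kappa + 1) 1)%N); last first.
    by rewrite sum_nat_const_nat; lia.
  by rewrite natr_sum; apply: ler_sum => j _; have /andP[] := b0 x j xD.
rewrite big_nat big1 // => j /andP[jlo jhi].
rewrite /b; case: ifP => // jn; apply: A0 => //; rewrite addn1.
have [ka|ak] := leqP kappa (a x).
  have := Nle kappa (a x); lia.
have := Nle (d x) kappa.-1; lia.
Qed.

(** * Reduction of the theorem to types *)

Lemma card_ord_itv (n p q : nat) :
  (q <= n)%N -> #|[set j : 'I_n | (p <= j < q)%N]%SET| = (q - p)%N.
Proof.
move=> qn; rewrite -subSS -[RHS]muln1 -sum_nat_const_nat.
rewrite (sum_slots _ _ qn) -sum1_card.
by apply: eq_bigl => j; rewrite inE.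
Qed.

Unset Implicit Arguments.
Set Strict Implicit.
Theorem theorem2 (R : realType) (n nu : nat) (N : nat -> nat) (h : nat -> nat)
  (l : R -> R) (r a d : R -> nat) :
  breakpoints n nu N ->
  block_monotone nu N h ->
  measurable_fun (`[0%R, 1%R] : set R) l ->
  measurable_fun (`[0%R, 1%R] : set R) r ->
  measurable_fun (`[0%R, 1%R] : set R) a ->
  measurable_fun (`[0%R, 1%R] : set R) d ->
  (forall x, x \in `[0%R, 1%R] -> 0 <= l x) ->
  (forall x, x \in `[0%R, 1%R] -> in_service_set nu N (r x) (a x) (d x)) ->
  (\int[@lebesgue_measure R]_(x in (`[0%R, 1%R] : set R)) (l x * (r x)%:R)%:E < +oo)%E ->
  (adequate_c n N h l r a d <->
   forall k : nat -> nat,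
     (forall kappa, (1 <= kappa <= nu)%N -> (k kappa <= N kappa - N kappa.-1)%N) ->
     (0 <= Wc nu N h l r a d k)%E).
Proof.
move=> brk hmono ml mr ma md l0 serv lr_fin.
have [_ N0 Nnu Nlt] := brk.
pose D : set R := `[0%R, 1%R]%classic.
have mD : measurable D by exact: measurable_itv.
have Nle i j : (i <= j <= nu)%N -> (N i <= N j)%N.
  move=> /andP[ij jnu]; apply: leq_steps => // m /andP[_ mj].
  by rewrite ltnW // Nlt // (leq_trans mj).
pose I : finType := ('I_n.+1 * 'I_nu.+1 * 'I_nu.+1)%type.
(* Membership in the service set bounds [r x] by [n] and [a x], [d x] by [nu], so [inord] loses
   nothing on the unit interval. *)
pose tau (x : R) : I := (inord (r x), inord (a x), inord (d x)).
have tauE x : D x -> [/\ (tau x).1.1 = r x :> nat, (tau x).1.2 = a x :> nat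
    & (tau x).2 = d x :> nat].
  move=> xD; have [ad dnu _ rN] := serv x xD.
  have := Nle (d x) nu; rewrite dnu leqnn Nnu => /(_ isT) Ndn.
  rewrite /tau /= !inordK //; lia.
have mtau s : measurable (D `&` [set x | tau x = s]).
  have -> : D `&` [set x | tau x = s] =
      (D `&` r @^-1` [set (s.1.1 : nat)])
      `&` (D `&` a @^-1` [set (s.1.2 : nat)])
      `&` (D `&` d @^-1` [set (s.2 : nat)]).
    apply/seteqP; split=> [x [xD /= <-]|x [[[xD /= rx] [_ /= ax]] [_ /= dx]]].
      by have [-> -> ->] := tauE x xD.
    split => //=; have [r' a' d'] := tauE x xD.
    rewrite [LHS]surjective_pairing [(tau x).1]surjective_pairing.
    rewrite [RHS]surjective_pairing [s.1]surjective_pairing.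
    by congr (_, _, _); apply: val_inj; rewrite /= ?r' ?a' ?d'.
  by apply: measurableI; [apply: measurableI; [apply: mr|apply: ma]|apply: md].
pose rwin k (s : I) := (s.1.1 - \sum_(s.1.2 + 1 <= kappa < s.2.+1) k kappa)%N.
have rwinE k x : D x -> rwin k (tau x)
    = (r x - \sum_(a x + 1 <= kappa < (d x).+1) k kappa)%N.
  by move=> xD; rewrite /rwin; have [-> -> ->] := tauE x xD.
split=> [adq k kN|W0].
  apply: (adequate_c_Wc_ge0 brk ml _ l0 serv kN adq); apply: measurable_funM => //.
  apply: (eq_measurable_fun (fun x => (rwin k (tau x))%:R : R)).
    by move=> x; rewrite inE => xD; rewrite rwinE.
  exact: (measurable_fun_fin_class (T' := R) (fun s => (rwin k s)%:R : R)).
have int_fin s :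
    (\int[@lebesgue_measure R]_(x in D) (l x * (tau x == s)%:R)%:E)%E
    \is a fin_num.
  rewrite ge0_fin_numE; last first.
    by apply: integral_ge0 => x xD; rewrite lee_fin mulr_ge0 ?l0.
  apply: le_lt_trans lr_fin; apply: ge0_le_integral => //=.
  - by move=> x xD; rewrite lee_fin mulr_ge0 ?l0.
  - apply/measurable_EFinP; apply: measurable_funM => //.
    exact: (measurable_fun_fin_class (T' := R) (fun s' => (s' == s)%:R : R)).
  - apply/measurable_EFinP; apply: measurable_funM => //.
    apply: (eq_measurable_fun (fun x => (tau x).1.1%:R : R)).
      by move=> x; rewrite inE => xD; have [-> _ _] := tauE x xD.
    exact: (measurable_fun_fin_class (T' := R) (fun s' : I => s'.1.1%:R : R)).
  (* The indicator of a type is at most [r x], because [r x] is at least 1. *)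
  - move=> x xD; rewrite lee_fin ler_wpM2l ?l0 // ler_nat.
    by have [_ _ r0 _] := serv x xD; apply: leq_trans r0; case: (_ == _).
pose c s := fine (\int[@lebesgue_measure R]_(x in D) (l x * (tau x == s)%:R)%:E)%E.
have intE (F : I -> R) : (forall s, 0 <= F s) ->
    (\int[@lebesgue_measure R]_(x in D) (l x * F (tau x))%:E)%E
    = (\sum_s c s * F s)%:E.
  move=> F0; rewrite -sumEFin.
  transitivity (\sum_s (F s)%:E *
      \int[@lebesgue_measure R]_(x in D) (l x * (tau x == s)%:R)%:E)%E.
    exact: ge0_integral_fin_class.
  by apply: eq_bigr => s _; rewrite -[X in (_ * X)%E]fineK // -EFinM mulrC.
pose win (s : I) : {set 'I_n} := [set j : 'I_n | (N s.1.2 <= j < N s.2)%N]%SET.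
(* Some triples in [I] are not services; the [minn] caps their demand at the window size and equals
   [r x] on every type that occurs. *)
have [s|s|T|A [A01 Aout Asum Aload]] := @fractional_allocation R I 'I_n c win
    (fun s => minn s.1.1 #|win s|) (fun j => (h j.+1)%:R).
- by apply: fine_ge0; apply: integral_ge0 => x xD; rewrite lee_fin mulr_ge0 ?l0.
- exact: geq_minr.
(* This [k] counts the slots of each block outside [T]; summed over the blocks of a window it gives
   the window slots outside [T], so the integral in [Wc] becomes the demand side of the condition
   for [T]. *)
- pose k kappa := (\sum_((N kappa.-1).+1 <= j < (N kappa).+1) ~~ slot_pred T j)%N.
  have kN kappa : (1 <= kappa <= nu)%N -> (k kappa <= N kappa - N kappa.-1)%N.
    move=> _; rewrite -[leqRHS]muln1 -subSS -sum_nat_const_nat.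
    by apply: leq_sum => j _; case: (slot_pred T j).
  have := W0 k kN; rewrite /Wc sube_ge0 ?orbT //.
  have -> : (\int[@lebesgue_measure R]_(x in (`[0%R, 1%R] : set R))
        (l x * (r x - \sum_(a x + 1 <= kappa < (d x).+1) k kappa)%N%:R)%:E)%E
      = (\int[@lebesgue_measure R]_(x in D)
        (l x * (minn (tau x).1.1 #|win (tau x)| - #|win (tau x) :\: T|)%N%:R)%:E)%E.
    apply: eq_integral => x; rewrite inE => xD.
    have [ad dnu _ rN] := serv x xD; have [-> ax dx] := tauE x xD.
    have Ndn : (N (d x) <= n)%N by rewrite -Nnu; apply: Nle; rewrite dnu leqnn.
    rewrite /win ax dx (card_window _ _ Ndn).
    rewrite (card_ord_itv _ Ndn) (minn_idPl rN).
    rewrite (@sum_blocks nat N _ (a x) (d x)) ?(ltnW ad) //.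
      by rewrite addn1.
    by move=> kappa /andP[_ kd]; rewrite ltnW // Nlt // (leq_trans kd).
  rewrite (intE (fun s => (minn s.1.1 #|win s| - #|win s :\: T|)%N%:R)) //.
  rewrite lee_fin => /le_trans; apply.
  rewrite -natr_sum; under [leLHS]eq_bigr do rewrite -natr_sum.
  rewrite -natr_sum ler_nat.
  have -> : (\sum_(j in T) h j.+1
      = \sum_(1 <= j < n.+1) if slot_pred T j then h j else 0)%N.
    rewrite (sum_slots 0 _ (leqnn n)) big_mkcond [RHS]big_mkcond.
    by apply: eq_bigr => j _; rewrite slot_predS ltn_ord.
  have := @sum_blocks nat N (fun j => if slot_pred T j then h j else 0%N) 0 nu isT.
  rewrite N0 Nnu => ->; last by move=> kappa /andP[_ knu]; rewrite ltnW // Nlt.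
  (* Block monotonicity enters here: in each block the tail sum is at most the sum over [T]. *)
  rewrite big_nat [leqRHS]big_nat; apply: leq_sum => kappa knu.
  rewrite -big_mkcond; apply: sum_tail_le; first by apply: Nle; lia.
  move=> i j pi ij jq; apply: (hmono kappa) => //.
  by rewrite addn1.
(* Slot [j] is the ordinal [j.-1]; the default 0 only concerns indices beyond [n], which
   [adequate_c] leaves free. *)
pose B (x : R) (j : nat) := if insub j.-1 is Some i then A (tau x) i else 0.
have BE x j : (1 <= j <= n)%N -> exists2 i : 'I_n, j = i.+1 & B x j = A (tau x) i.
  case: j => // j jn; exists (Ordinal jn) => //.
  by rewrite /B /= insubT.
exists B; split.
- move=> j jn; rewrite /B; case: insub => [i|]; last exact: measurable_cst.
  exact: (measurable_fun_fin_class (T' := R) (fun s => A s i)).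
- by move=> x xD j jn; have [i _ ->] := BE x j jn; apply: A01.
- move=> x xD j jn jout; have [i ji ->] := BE x j jn; apply: Aout.
  have [_ ax dx] := tauE x xD.
  by rewrite inE ax dx; move: jout; rewrite ji addn1.
- move=> x xD; rewrite (sum_slots 0 _ (leqnn n)).
  under eq_bigr do rewrite /B /= valK.
  under eq_bigl do rewrite ltn_ord.
  rewrite Asum /win; have [-> -> ->] := tauE x xD; have [ad dnu _ rN] := serv x xD.
  rewrite card_ord_itv; first by rewrite (minn_idPl rN).
  by rewrite -Nnu; apply: Nle; rewrite dnu leqnn.
- move=> j jn; have [i ji _] := BE 0 j jn.
  rewrite (_ : (\int[_]_(_ in _) _)%E
    = (\int[@lebesgue_measure R]_(x in D) (l x * A (tau x) i)%:E)%E); last first.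
    by apply: eq_integral => x _; rewrite /B ji /= valK.
  rewrite (intE (fun s => A s i)) ?lee_fin ?ji //.
  by move=> s; have /andP[] := A01 s i.
Qed.
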